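(* Let $d\ge1$. For every $T\in\mathcal{S}'(\mathbb{R}^d)$, every $\varphi\in\mathcal{S}(\mathbb{R}^d)$ and every multi-index $n\in\mathbb{N}_0^d$, the function $x\mapsto x^n\varphi(x)$ belongs to $\mathcal{S}(\mathbb{R}^d)$, so that the weak moment ${}^{(\varphi)}m_n=\langle T,x^n\varphi(x)\rangle$ is well defined. That is, weak moments of all orders exist for every pair $(T,\varphi)$.
   Context: $\mathcal{S}(\mathbb{R}^d)$ is the Schwartz space and $\mathcal{S}'(\mathbb{R}^d)$ the space of tempered distributions. A distribution--kernel pair is a pair $(T,\varphi)$ with $T\in\mathcal{S}'(\mathbb{R}^d)$ and $\varphi\in\mathcal{S}(\mathbb{R}^d)$. Its $n$-th weak moment is ${}^{(\varphi)}m_n:=\langle T,x^n\varphi(x)\rangle$, where $x^n=x_1^{n_1}\cdots x_d^{n_d}$. *)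

(* Defs.v *)
From HB Require Import structures.
From mathcomp Require Import all_boot all_order all_algebra.
From mathcomp Require Import all_classical all_reals all_analysis.
From mathcomp Require Import complex.

Set Implicit Arguments.
Unset Strict Implicit.
Unset Printing Implicit Defensive.

Import Order.TTheory GRing.Theory Num.Theory.
Import numFieldNormedType.Exports.

Local Open Scope classical_set_scope.
Local Open Scope complex_scope.
Local Open Scope ring_scope.

(* Test functions are complex-valued functions on R^d = 'rV[R]_d, where C is
   R[i] and normc : R[i] -> R is the complex modulus. *)

Definition multi_index (d : nat) := {ffun 'I_d -> nat}.

Definition monomial (R : realType) (d : nat) (n : multi_index d)
    (x : 'rV[R]_d) : R :=
  \prod_(i < d) x 0 i ^+ n i.

Section PartialDerivatives.
Variables (R : realType) (d : nat).
Implicit Types (f : 'rV[R]_d -> R[i]) (i : 'I_d) (s : seq 'I_d).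

(* R[i] is a normed module over itself but not over R, so the library's real
   directional derivatives apply to the real and imaginary parts. *)
Definition partial_exists i f (x : 'rV[R]_d) : Prop :=
  derivable (fun y => complex.Re (f y)) x (delta_mx 0 i) /\
  derivable (fun y => complex.Im (f y)) x (delta_mx 0 i).

Definition partial i f : 'rV[R]_d -> R[i] := fun x =>
  'D_(delta_mx 0 i) (fun y => complex.Re (f y)) x +i*
  'D_(delta_mx 0 i) (fun y => complex.Im (f y)) x.

(* partials [:: i1; ...; ik] f = d_i1 (... (d_ik f)) *)
Definition partials s f : 'rV[R]_d -> R[i] := foldr partial f s.

Definition smooth f : Prop := forall s,
  continuous (partials s f : 'rV[R]_d -> R[i]^o) /\
  forall i x, partial_exists i (partials s f) x.

(* The list 0, ..., 0, 1, ..., 1, ..., in which i occurs b i times. *)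
Definition multi_index_seq (b : multi_index d) : seq 'I_d :=
  flatten [seq nseq (b i) i | i <- enum 'I_d].

(* d^b f = d_0^(b 0) ... d_(d-1)^(b (d-1)) f *)
Definition mpartial (b : multi_index d) f : 'rV[R]_d -> R[i] :=
  partials (multi_index_seq b) f.

Definition weighted (a b : multi_index d) f (x : 'rV[R]_d) : R :=
  ComplexField.Normc.normc ((monomial a x)%:C * mpartial b f x).

Definition is_schwartz f : Prop :=
  smooth f /\ forall a b : multi_index d, has_ubound (range (weighted a b f)).

Definition schwartz_seminorm (ab : multi_index d * multi_index d) f : R :=
  sup (range (weighted ab.1 ab.2 f)).

Definition schwartz_pred : {pred 'rV[R]_d -> R[i]} :=
  mem [set f | is_schwartz f].

End PartialDerivatives.

Section SchwartzSubmodule.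
Variables (R : realType) (d : nat).
Implicit Types (f g : 'rV[R]_d -> R[i]) (c : R[i]).

Let ReD c (u v : R[i]) : complex.Re (c * u + v) =
  complex.Re c * complex.Re u - complex.Im c * complex.Im u + complex.Re v.
Proof. by case: c u v => [? ?] [? ?] [? ?]. Qed.

Let ImD c (u v : R[i]) : complex.Im (c * u + v) =
  complex.Re c * complex.Im u + complex.Im c * complex.Re u + complex.Im v.
Proof. by case: c u v => [? ?] [? ?] [? ?]. Qed.

Lemma derivative_comb (a b : R) (u v w : 'rV[R]_d -> R) x e :
  derivable u x e -> derivable v x e -> derivable w x e ->
  is_derive x e (fun y => a * u y + b * v y + w y)
    (a * 'D_e u x + b * 'D_e v x + 'D_e w x).
Proof.
move=> /derivableP du /derivableP dv /derivableP dw.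
exact: (is_deriveD (is_deriveD (is_deriveZ a du) (is_deriveZ b dv)) dw).
Qed.

Lemma continuous_comb (K : numFieldType) (V : topologicalType) (c : K)
    (f g : V -> K^o) :
  continuous f -> continuous g -> continuous (fun x => c * f x + g x : K^o).
Proof.
move=> cf cg x; apply: cvgD; last exact: cg.
by apply: cvgM; [exact: cvg_cst | exact: cf].
Qed.

Lemma partial_linear c f g i x :
  partial_exists i f x -> partial_exists i g x ->
  partial_exists i (c *: f + g) x /\
  partial i (c *: f + g) x = c * partial i f x + partial i g x.
Proof.
move=> [rf mf] [rg mg].
have HR : (fun y => complex.Re ((c *: f + g) y)) =
    (fun y => complex.Re c * complex.Re (f y) +
              (- complex.Im c) * complex.Im (f y) + complex.Re (g y)).
  by apply/funext => y; rewrite ReD mulNr.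
have HI : (fun y => complex.Im ((c *: f + g) y)) =
    (fun y => complex.Re c * complex.Im (f y) +
              complex.Im c * complex.Re (f y) + complex.Im (g y)).
  by apply/funext => y; rewrite ImD.
have [dR eR] := derivative_comb (complex.Re c) (- complex.Im c) rf mf rg.
have [dI eI] := derivative_comb (complex.Re c) (complex.Im c) mf rf mg.
rewrite /partial_exists /partial HR HI; split; first by split.
rewrite eR eI; apply/eqP; rewrite eq_complex ReD ImD /= mulNr.
by rewrite !eqxx.
Qed.

Lemma partials_linear c f g s : smooth f -> smooth g ->
  partials s (c *: f + g) = c *: partials s f + partials s g.
Proof.
move=> sf sg; elim: s => //= i s ->.
apply/funext => x.
by have [] := partial_linear c ((sf s).2 i x) ((sg s).2 i x).
Qed.

Lemma smooth_linear c f g : smooth f -> smooth g -> smooth (c *: f + g).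
Proof.
move=> sf sg s; rewrite partials_linear //; split=> [x|i x]; last first.
  by have [] := partial_linear c ((sf s).2 i x) ((sg s).2 i x).
exact: (continuous_comb (c := c) (sf s).1 (sg s).1).
Qed.

Let normcD (u v : R[i]) : ComplexField.Normc.normc (u + v) <=
  ComplexField.Normc.normc u + ComplexField.Normc.normc v.
Proof. exact: le_normcD. Qed.

Lemma weighted_linear a b c f g x : smooth f -> smooth g ->
  weighted a b (c *: f + g) x <=
  ComplexField.Normc.normc c * weighted a b f x + weighted a b g x.
Proof.
move=> sf sg; rewrite /weighted /mpartial partials_linear //.
rewrite [(_ + _) x]/(c * _ + _) mulrDr mulrCA.
by rewrite (le_trans (normcD _ _)) // ComplexField.Normc.normcM.
Qed.

Lemma weighted_ge0 a b f x : 0 <= weighted a b f x.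
Proof. by rewrite /weighted; case: (_ * _) => u v; exact: sqrtr_ge0. Qed.

Lemma schwartz_linear c f g :
  is_schwartz f -> is_schwartz g -> is_schwartz (c *: f + g).
Proof.
move=> [sf bf] [sg bg]; split; first exact: smooth_linear.
move=> a b; have [M Mf] := bf a b; have [N Ng] := bg a b.
exists (ComplexField.Normc.normc c * M + N) => _ [x _ <-].
apply: (le_trans (weighted_linear _ _ _ _ sf sg)); apply: lerD.
  apply: ler_wpM2l; last by apply: Mf; exists x.
  by case: c => u v; exact: sqrtr_ge0.
by apply: Ng; exists x.
Qed.

Lemma partials0 s : partials s (0 : 'rV[R]_d -> R[i]) = 0.
Proof.
elim: s => //= i s ->; apply/funext => x; rewrite /partial.
by rewrite !derive_cst.
Qed.

Lemma schwartz0 : is_schwartz (0 : 'rV[R]_d -> R[i]).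
Proof.
split=> [s|a b].
  rewrite partials0; split=> [|i x].
    exact: (@cst_continuous 'rV[R]_d (R[i]^o) 0).
  by split; exact: derivable_cst.
exists 0 => _ [x _ <-].
by rewrite /weighted /mpartial partials0 mulr0 ComplexField.Normc.normc0.
Qed.

Lemma schwartz_submod_closed : submod_closed (@schwartz_pred R d).
Proof.
split=> [|c f g]; rewrite !inE; first exact: schwartz0.
exact: schwartz_linear.
Qed.

HB.instance Definition _ :=
  GRing.isSubmodClosed.Build R[i] ('rV[R]_d -> R[i]) (@schwartz_pred R d)
    schwartz_submod_closed.

End SchwartzSubmodule.

Section SchwartzSpace.
Variables (R : realType) (d : nat).

Record schwartz := Schwartz {
  schwartz_fun :> 'rV[R]_d -> R[i];
  schwartz_funP : schwartz_fun \in @schwartz_pred R d }.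

HB.instance Definition _ := [isSub for schwartz_fun].
HB.instance Definition _ := [Choice of schwartz by <:].
HB.instance Definition _ := [SubChoice_isSubLmodule of schwartz by <:].

Implicit Types (f g h : schwartz).

Lemma is_schwartzP f : is_schwartz f.
Proof. by have := schwartz_funP f; rewrite inE. Qed.

(* The locally convex topology generated by all the seminorms
   sup_x |x^a d^b f(x)|. *)
Definition schwartz_basic (f : schwartz)
    (F : seq (multi_index d * multi_index d) * R) : set schwartz :=
  [set g | forall ab, ab \in F.1 -> schwartz_seminorm ab (g - f) < F.2].

Definition schwartz_nbhs (f : schwartz) : set_system schwartz :=
  filter_from [set F | 0 < F.2] (schwartz_basic f).

HB.instance Definition _ := hasNbhs.Build schwartz schwartz_nbhs.

Lemma schwartz_seminorm0 ab : schwartz_seminorm ab (0 : schwartz) = 0.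
Proof.
rewrite /schwartz_seminorm (_ : range _ = [set 0]) ?sup1 //.
apply/seteqP; split=> [_ [x _ <-]|_ ->] /=; last exists 0 => //.
all: by rewrite /weighted /mpartial partials0 mulr0 ComplexField.Normc.normc0.
Qed.

Lemma schwartz_seminormD ab f g :
  schwartz_seminorm ab (f + g) <=
  schwartz_seminorm ab f + schwartz_seminorm ab g.
Proof.
have [sf bf] := is_schwartzP f; have [sg bg] := is_schwartzP g.
apply: ge_sup; first by exists (weighted ab.1 ab.2 (f + g) 0); exists 0.
move=> _ [x _ <-].
have := weighted_linear ab.1 ab.2 1 x sf sg.
rewrite scale1r ComplexField.Normc.normc1 mul1r => /le_trans -> //.
by apply: lerD; apply: ub_le_sup => //; exists x.
Qed.

Lemma schwartz_nbhs_filter f : ProperFilter (nbhs f).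
Proof.
apply: filter_from_proper.
  apply: filter_from_filter; first by exists ([::], 1) => /=.
  move=> [F e] [G r] /= e0 r0; exists (F ++ G, Order.min e r) => /=.
    by rewrite lt_min e0.
  move=> g /= H; split=> ab /= abF.
    by have := H ab; rewrite mem_cat abF lt_min => /(_ isT)/andP[].
  by have := H ab; rewrite mem_cat abF orbT lt_min => /(_ isT)/andP[].
by move=> [F e] /= e0; exists f => ab _ /=; rewrite subrr schwartz_seminorm0.
Qed.

Lemma schwartz_nbhs_singleton f (A : set schwartz) : nbhs f A -> A f.
Proof.
by case=> -[F e] /= e0; apply=> ab _ /=; rewrite subrr schwartz_seminorm0.
Qed.

Lemma schwartz_nbhs_nbhs f (A : set schwartz) :
  nbhs f A -> nbhs f (nbhs^~ A).
Proof.
case=> -[F e] /= e0 FA; exists (F, e / 2) => /=; first exact: divr_gt0.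
move=> g /= fg; exists (F, e / 2) => /=; first exact: divr_gt0.
move=> h /= gh; apply: FA => ab /= abF.
have := schwartz_seminormD ab (h - g) (g - f).
rewrite addrA subrK => /le_lt_trans; apply.
by rewrite [e]splitr; apply: ltrD; [exact: gh | exact: fg].
Qed.

HB.instance Definition _ := Nbhs_isNbhsTopological.Build schwartz
  schwartz_nbhs_filter schwartz_nbhs_singleton schwartz_nbhs_nbhs.

Record tempered_distribution := TemperedDistribution {
  tempered_fun :> {linear schwartz -> R[i]^o};
  tempered_continuous : continuous tempered_fun }.

Definition monomial_mul (n : multi_index d) (f : 'rV[R]_d -> R[i]) :
    'rV[R]_d -> R[i] :=
  fun x => (monomial n x)%:C * f x.

(* m = <T, x^n phi>: the pairing is only meaningful when x^n phi is a Schwartz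
   function, i.e. underlies some element psi of the domain of T. *)
Definition is_weak_moment (T : tempered_distribution) (phi : schwartz)
    (n : multi_index d) (m : R[i]) : Prop :=
  exists psi : schwartz,
    (psi : 'rV[R]_d -> R[i]) = monomial_mul n phi /\ m = T psi.

End SchwartzSpace.

(* Main.v *)
(* By the Leibniz rule, an iterated derivative of [x_j f] along a list [s] of
   directions is [x_j] times that derivative of [f], plus derivatives of [f]
   along sublists of [s].  The seminorms only involve sorted lists of
   directions, and a sublist of a sorted list is sorted, so each of these terms
   is bounded by a seminorm of [f] without appeal to the equality of mixed
   partial derivatives.  Hence multiplication by a coordinate preserves Schwartz
   functions, and a monomial is a product of coordinates. *)

Require Import Defs.
From mathcomp Require Import all_boot all_order all_algebra.
From mathcomp Require Import all_classical all_reals all_analysis.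
From mathcomp Require Import complex.

Import Order.TTheory GRing.Theory Num.Theory.
Import numFieldNormedType.Exports.

Local Open Scope complex_scope.
Local Open Scope ring_scope.

Lemma continuous_real_complex (R : realType) :
  continuous (fun r : R => r%:C : R[i]^o).
Proof.
move=> r; apply/cvgrPdist_lt => -[e e'].
(* In the order of [R[i]], positivity of [e +i* e'] forces [e' = 0], so the tolerance is a real
   number. *)
rewrite ltcE /= => /andP[/eqP -> e0].
near=> s.
rewrite -rmorphB /= normc_def /= expr0n /= addr0 sqrtr_sqr ltcR.
by near: s; exact: (cvgr_dist_lt id r cvg_id).
Unshelve. all: by end_near.
Qed.

Section CoordinateMultiplication.
Context {R : realType} {d : nat}.
Implicit Types (f : 'rV[R]_d -> R[i]) (i j : 'I_d) (s t : seq 'I_d).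

Definition coord_mul j f : 'rV[R]_d -> R[i] :=
  fun x => (x 0 j)%:C * f x.

Lemma is_derive_coord i j (x : 'rV[R]_d) :
  is_derive x (delta_mx 0 i) (fun y : 'rV[R]_d => y 0 j : R) (i == j)%:R.
Proof.
have df := differentiable_coord x 0 j.
apply: DeriveDef; first exact: diff_derivable.
(* The difference quotient of a coordinate does not depend on [h] once [h != 0]. *)
rewrite /derive; apply/lim_near_cst => //.
near=> h; rewrite /= !mxE /= addrK eq_sym.
have h0 : h != 0 by near: h; exact: nbhs_dnbhs_neq.
by case: (i == j); rewrite ?mulr0 ?scaler0 // mulr1; exact: mulVf.
Unshelve. all: by end_near.
Qed.

(** The factor [x 0 j] is real, so real and imaginary parts do not mix and the real product rule
    applies to each. *)
Lemma partial_coord_mul i j f x : partial_exists i f x ->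
  partial_exists i (coord_mul j f) x /\
  partial i (coord_mul j f) x =
    coord_mul j (partial i f) x + (i == j)%:R * f x.
Proof.
move=> [/derivableP rf /derivableP mf].
have HR : (fun y => complex.Re (coord_mul j f y)) =
    (fun y : 'rV[R]_d => y 0 j) * (fun y => complex.Re (f y)).
  apply/funext => y; rewrite /coord_mul [RHS]/(_ * _).
  by case: (f y) => a b /=; rewrite mul0r subr0.
have HI : (fun y => complex.Im (coord_mul j f y)) =
    (fun y : 'rV[R]_d => y 0 j) * (fun y => complex.Im (f y)).
  apply/funext => y; rewrite /coord_mul [RHS]/(_ * _).
  by case: (f y) => a b /=; rewrite mul0r addr0.
have [dR eR] := is_deriveM (is_derive_coord i j x) rf.
have [dI eI] := is_deriveM (is_derive_coord i j x) mf.
rewrite /partial_exists /partial HR HI; split; first by split.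
rewrite eR eI /coord_mul /=; case: (f x) => a b /=.
by case: (i == j); apply/eqP; rewrite eq_complex /= !(mulr0, mulr1, mul0r,
  mul1r, subr0, addr0, scaler0, add0r, oppr0) ?[_ *: 1]mulr1 !eqxx.
Qed.

Lemma smooth_partials f s : smooth f -> smooth (partials s f).
Proof. by move=> sf t; rewrite /partials -foldr_cat; exact: sf. Qed.

Lemma smooth_sum (I : Type) (r : seq I) (F : I -> 'rV[R]_d -> R[i]) :
  (forall k, smooth (F k)) -> smooth (\sum_(k <- r) F k).
Proof.
move=> sF; elim: r => [|k r IH].
  by rewrite big_nil; exact: (schwartz0 R d).1.
by rewrite big_cons -[F k]scale1r; exact: smooth_linear.
Qed.

Lemma partials_coord_mul j f s : smooth f ->
  exists2 L : seq (seq 'I_d), {in L, forall t, subseq t s} &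
    partials s (coord_mul j f) =
    coord_mul j (partials s f) + \sum_(t <- L) partials t f.
Proof.
move=> sf; elim: s => [|i s [L Ls IH]].
  by exists [::] => //=; rewrite big_nil addr0.
have sh : smooth (\sum_(t <- L) partials t f).
  by apply: smooth_sum => t; exact: smooth_partials.
(* The derivative hits either the coordinate, leaving [partials s f] exactly when [i = j], or an
   earlier remainder term, whose list gains the head [i]. *)
exists ((if i == j then [:: s] else [::]) ++ map (cons i) L).
  move=> t; rewrite mem_cat => /orP[|/mapP[u uL ->]].
    by case: ifP => // _; rewrite inE => /eqP ->; exact: subseq_cons.
  by rewrite /= eqxx; exact: Ls.
rewrite /= IH; apply/funext => x.
have [ec pc] := partial_coord_mul i j _ x ((sf s).2 i x).
have [_] := partial_linear 1 ec ((sh [::]).2 i x).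
rewrite scale1r mul1r => ->; rewrite pc -addrA; congr (_ + _).
rewrite big_cat big_map [RHS]/(_ + _); congr (_ + _).
  by case: (i == j); rewrite ?big_seq1 ?big_nil ?mul1r ?mul0r.
have -> : partial i (\sum_(t <- L) partials t f) =
    \sum_(t <- L) partials (i :: t) f; last by [].
elim: (L) => [|t M IHM]; first by rewrite !big_nil; exact: (partials0 _ [:: i]).
rewrite !big_cons -IHM -[partials t f]scale1r.
have /= -> := partials_linear 1 [:: i] (smooth_partials f t sf)
  (smooth_sum _ M _ (fun u => smooth_partials f u sf)).
by rewrite !scale1r.
Qed.

(** The Leibniz formula writes each iterated derivative as a sum of functions that are continuous
    and have all partial derivatives. *)
Lemma smooth_coord_mul j f : smooth f -> smooth (coord_mul j f).
Proof.
move=> sf s; have [L _ ->] := partials_coord_mul j f s sf.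
rewrite -[coord_mul _ _]scale1r.
have sh : smooth (\sum_(t <- L) partials t f).
  by apply: smooth_sum => t; exact: smooth_partials.
split=> [|i x].
  apply: continuous_comb; last exact: (sh [::]).1.
  have cX : continuous (fun y : 'rV[R]_d => (y 0 j)%:C : R[i]^o).
    move=> y; apply: (@continuous_comp _ _ _ (fun y : 'rV[R]_d => y 0 j)
      (fun r : R => r%:C : R[i]^o)).
      exact: coord_continuous.
    exact: continuous_real_complex.
  by move=> x; exact: (continuousM (cX x) ((sf s).1 x)).
have [ec _] := partial_coord_mul i j _ x ((sf s).2 i x).
by have [] := partial_linear 1 ec ((sh [::]).2 i x).
Qed.

Lemma count_multi_index_seq (b : multi_index d) i :
  count_mem i (multi_index_seq b) = b i.
Proof.
rewrite count_flatten -map_comp sumnE big_map big_enum /= (bigD1 i) //=.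
rewrite count_nseq /= eqxx mul1n big1 ?addn0 // => k /negbTE ki.
by rewrite count_nseq /= ki.
Qed.

Lemma sorted_multi_index_seq (b : multi_index d) :
  sorted (relpre val leq) (multi_index_seq b).
Proof.
have tr : transitive (relpre (@nat_of_ord d) leq).
  by move=> ? ? ?; exact: leq_trans.
rewrite sorted_pairwise //.
have : pairwise (relpre (@nat_of_ord d) leq) (enum 'I_d).
  by rewrite -sorted_pairwise // -sorted_map val_enum_ord iota_sorted.
rewrite /multi_index_seq; elim: (enum _) => //= i s IH /andP[/allP ls ps].
rewrite pairwise_cat IH // andbT; apply/andP; split.
  apply/allrelP => x y /nseqP[-> _] /flatten_mapP[k ks /nseqP[-> _]].
  exact: ls.
by elim: (b i) => //= n ->; rewrite andbT all_nseq /= leqnn orbT.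
Qed.

(** A sorted list is determined by the multiplicities of its entries, so [t] is rebuilt from its own
    counts. *)
Lemma subseq_multi_index_seq (b : multi_index d) t :
  subseq t (multi_index_seq b) ->
  exists c : multi_index d, t = multi_index_seq c.
Proof.
move=> tb; exists [ffun i => count_mem i t].
apply: (@sorted_eq _ (relpre val leq)).
- by move=> ? ? ?; exact: leq_trans.
- by move=> u v /anti_leq/val_inj.
- apply: subseq_sorted tb (sorted_multi_index_seq b).
  by move=> ? ? ?; exact: leq_trans.
- exact: sorted_multi_index_seq.
by apply/allP => i _; rewrite /= count_multi_index_seq ffunE.
Qed.

Definition incr_index (a : multi_index d) j : multi_index d :=
  [ffun i => (a i + (i == j))%N].

Lemma monomial_incr a j (x : 'rV[R]_d) :
  monomial (incr_index a j) x = monomial a x * x 0 j.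
Proof.
rewrite /monomial (eq_bigr (fun i => x 0 i ^+ a i * x 0 i ^+ (i == j))).
  rewrite big_split /=; congr (_ * _).
  rewrite (bigD1 j) //= eqxx expr1 big1 ?mulr1 // => i /negbTE ->.
  by rewrite expr0.
by move=> i _; rewrite ffunE exprD.
Qed.

Lemma schwartz_coord_mul j f : is_schwartz f -> is_schwartz (coord_mul j f).
Proof.
move=> [sf bf]; split; first exact: smooth_coord_mul.
move=> a b.
have [L Ls eL] := partials_coord_mul j f (multi_index_seq b) sf.
(* Each remainder term is a [weighted a c f] for some [c]; the bounds add up along [L]. *)
have [N HN] : exists N, forall x, ComplexField.Normc.normc
    ((monomial a x)%:C * (\sum_(t <- L) partials t f) x) <= N.
  elim: L Ls {eL} => [_|t L IH Ls].
    by exists 0 => x; rewrite big_nil mulr0 ComplexField.Normc.normc0.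
  have [|N HN] := IH; first by move=> u uL; apply: Ls; rewrite inE uL orbT.
  have [|c tc] := subseq_multi_index_seq b t; first by apply: Ls; exact: mem_head.
  have [M HM] := bf a c.
  exists (M + N) => x; rewrite big_cons [(_ + _) x]/(_ + _) mulrDr.
  apply: le_trans (le_normcD _ _) _; apply: lerD => //.
  by rewrite tc; apply: HM; exists x.
(* In the leading term the extra factor [x 0 j] is absorbed into the weight. *)
have [M HM] := bf (incr_index a j) b.
exists (M + N) => _ [x _ <-].
rewrite /weighted /mpartial eL [(_ + _) x]/(_ + _) mulrDr.
apply: le_trans (le_normcD _ _) _; apply: lerD => //.
rewrite /coord_mul mulrA -rmorphM -monomial_incr.
by apply: HM; exists x.
Qed.

Lemma schwartz_monomial_mul (n : multi_index d) f :
  is_schwartz f -> is_schwartz (monomial_mul n f).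
Proof.
move=> sf.
have sX j k g : is_schwartz g -> is_schwartz (iter k (coord_mul j) g).
  by move=> sg; elim: k => //= k; exact: schwartz_coord_mul.
have iterE j k g x : iter k (coord_mul j) g x = (x 0 j ^+ k)%:C * g x.
  elim: k => [|k IH] /=; first by rewrite mul1r.
  by rewrite /coord_mul IH mulrA -rmorphM -exprS.
rewrite /monomial_mul /monomial.
(* Induction on the list of coordinates in the product: each new [j] contributes [n j]
   multiplications by [x 0 j]. *)
elim: (index_enum _) => [|j r IH].
  by under eq_fun do rewrite big_nil mul1r.
have := sX j (n j) _ IH; congr is_schwartz; apply/funext => x.
by rewrite iterE big_cons rmorphM mulrA.
Qed.

End CoordinateMultiplication.

Theorem proposition2p17 (R : realType) (d : nat) (d_ge1 : (1 <= d)%N)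
    (T : tempered_distribution R d) (phi : schwartz R d) (n : multi_index d) :
  is_schwartz (fun x : 'rV[R]_d => (monomial n x)%:C * phi x) /\
  exists! m : R[i], is_weak_moment T phi n m.
Proof.
have sP : is_schwartz (monomial_mul n phi).
  exact: schwartz_monomial_mul (is_schwartzP phi).
split=> //.
have sP' : monomial_mul n phi \in @schwartz_pred R d by rewrite inE.
exists (T (Schwartz sP')); split; first by exists (Schwartz sP').
(* An element of [schwartz] is determined by its underlying function, so the value of [T] does not
   depend on the chosen [psi]. *)
by move=> m [psi [psiE ->]]; congr (T _); apply: val_inj; rewrite /= psiE.
Qed.
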